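(* Let $A = \{u_1, \dots, u_n\}$ be a basis of $\mathfrak{C}$ of size $n \geq 3$. Let $B = \{u_1, \dots, u_{n-1}, u_n0, u_n1\}$. Then Thompson's group $V$ satisfies $V = \langle \mathrm{Alt}(A), \mathrm{Alt}(B) \rangle$.
   Context: Let $\mathfrak{C} = \{0,1\}^{\omega}$ be Cantor space. For $u \in \{0,1\}^*$ let $u\mathfrak{C} = \{uw \mid w \in \mathfrak{C}\}$. A finite set $A \subseteq \{0,1\}^*$ is a basis of $\mathfrak{C}$ if $\{u\mathfrak{C} \mid u \in A\}$ is a partition of $\mathfrak{C}$. Thompson's group $V$ is the group of homeomorphisms $\gamma$ of $\mathfrak{C}$ (acting on the right) for which there exists a bijection $g\colon A \to B$ between two bases $A$ and $B$ of $\mathfrak{C}$ such that $(uw)\gamma = (ug)w$ for all $u \in A$ and $w \in \mathfrak{C}$. For a basis $A$, each permutation $g \in \mathrm{Sym}(A)$ is identified with the element of $V$ given by $uw \mapsto (ug)w$ for $u \in A$, $w \in \mathfrak{C}$; in this way $\mathrm{Sym}(A)$ and the alternating group $\mathrm{Alt}(A)$ are regarded as subgroups of $V$. *)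

(* Defs.v *)
From HB Require Import structures.
From mathcomp Require Import all_boot all_order all_fingroup all_solvable.
From mathcomp Require Import finmap.
From mathcomp Require Import all_classical topology cantor.

Set Implicit Arguments.
Unset Strict Implicit.
Unset Printing Implicit Defensive.

Local Open Scope classical_set_scope.

Record homeo (T : topologicalType) := Homeo {
  homeo_fun :> T -> T;
  homeo_inv : T -> T;
  homeo_funK : cancel homeo_fun homeo_inv;
  homeo_invK : cancel homeo_inv homeo_fun;
  homeo_fun_continuous : continuous homeo_fun;
  homeo_inv_continuous : continuous homeo_inv
}.

HB.instance Definition _ (T : topologicalType) := gen_eqMixin (homeo T).
HB.instance Definition _ (T : topologicalType) := gen_choiceMixin (homeo T).

Section HomeoGroup.
Variable T : topologicalType.
Implicit Types f g h : homeo T.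

Lemma homeo_eqP f g : (forall x, f x = g x) -> f = g.
Proof.
case: f g => [f f' fK f'K cf cf'] [g g' gK g'K cg cg'] /= fg.
have efg : f = g by apply: funext.
subst g; have efg' : f' = g' by apply: funext => y; rewrite -{1}(g'K y) fK.
subst g'; congr Homeo; exact: Prop_irrelevance.
Qed.

Lemma homeo_comp_continuous f g : continuous (g \o f).
Proof. by move=> x; apply: continuous_comp; apply: homeo_fun_continuous. Qed.

Lemma homeo_comp_inv_continuous f g :
  continuous (homeo_inv f \o homeo_inv g).
Proof. by move=> x; apply: continuous_comp; apply: homeo_inv_continuous. Qed.

Definition homeo_one : homeo T :=
  @Homeo T idfun idfun (fun=> erefl) (fun=> erefl)
    (fun x => @cvg_id _ (nbhs x)) (fun x => @cvg_id _ (nbhs x)).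

Definition homeo_invh f : homeo T :=
  @Homeo T (homeo_inv f) f (@homeo_invK T f) (@homeo_funK T f)
    (@homeo_inv_continuous T f) (@homeo_fun_continuous T f).

(* Homeomorphisms act on the right: the product f * g is "f, then g". *)
Definition homeo_mul f g : homeo T :=
  @Homeo T (g \o f) (homeo_inv f \o homeo_inv g)
    (can_comp (@homeo_funK T g) (@homeo_funK T f))
    (can_comp (@homeo_invK T f) (@homeo_invK T g))
    (@homeo_comp_continuous f g) (@homeo_comp_inv_continuous f g).

Lemma homeo_mulA : associative homeo_mul.
Proof. by move=> f g h; apply: homeo_eqP. Qed.

Lemma homeo_mul1 : left_id homeo_one homeo_mul.
Proof. by move=> f; apply: homeo_eqP. Qed.

Lemma homeo_mulr1 : right_id homeo_one homeo_mul.
Proof. by move=> f; apply: homeo_eqP. Qed.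

Lemma homeo_mulV : left_inverse homeo_one homeo_invh homeo_mul.
Proof. by move=> f; apply: homeo_eqP => x; apply: homeo_invK. Qed.

Lemma homeo_mulrV : right_inverse homeo_one homeo_invh homeo_mul.
Proof. by move=> f; apply: homeo_eqP => x; apply: homeo_funK. Qed.

HB.instance Definition _ := isGroup.Build (homeo T)
  homeo_mulA homeo_mul1 homeo_mulr1 homeo_mulV homeo_mulrV.

End HomeoGroup.

Definition generated_subgroup (G : groupType) (S : set G) : set G :=
  smallest (fun H : set G => group_closed [in H]) S.

Definition word := seq bool.

Definition prepend (u : word) (w : cantor_space) : cantor_space :=
  fun i => if (i < size u)%N then nth false u i else w (i - size u)%N.

Definition cone (u : word) : set cantor_space := range (prepend u).

Definition is_basis (A : {fset word}) : Prop :=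
  partition [set` A] cone [set: cantor_space].

Definition prefix_replacement (A B : {fset word}) (g : A -> B)
    (gamma : homeo cantor_space) : Prop :=
  forall (u : A) (w : cantor_space),
    gamma (prepend (val u) w) = prepend (val (g u)) w.

Definition thompson_V : set (homeo cantor_space) :=
  [set gamma | exists A B : {fset word}, [/\ is_basis A, is_basis B &
     exists g : A -> B, bijective g /\ prefix_replacement g gamma]].

(* The image of a set of permutations of A in the homeomorphism group. When A
   is a basis, each g : {perm A} has exactly one gamma with
   prefix_replacement g gamma. *)
Definition perm_image (A : {fset word}) (S : {set {perm A}}) :
    set (homeo cantor_space) :=
  [set gamma | exists2 g : {perm A}, g \in S & prefix_replacement g gamma].

Definition Alt_of (A : {fset word}) : set (homeo cantor_space) :=
  perm_image ('Alt_A)%g.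

(* Main.v *)
(* Write H for the subgroup. If H contains all 3-cycles of the basis C and of
   one expansion of C (a word u replaced by u0, u1), then conjugating by a
   3-cycle of C moves the caret, so H contains the 3-cycles of every expansion
   of C. Expanding C at x and at y gives two bases whose 3-cycles together
   generate those of the expansion at both x and y. By induction H contains the
   3-cycles of all iterated expansions of A. It follows that
   - H contains all transpositions of words of such a basis, because
     (a b) = (a0 b0)(a1 b1) is even after expanding;
   - H carries any iterated expansion of A to any other one of the same size,
     by moving carets one at a time.
   An element of V maps the basis D of all words of a large fixed length to a
   basis E all of whose words are long; both refine A, hence are iterated
   expansions of A, so up to an element of H it permutes D. *)
Require Import Defs.
From HB Require Import structures.
From mathcomp Require Import all_boot all_order all_fingroup all_solvable.
From mathcomp Require Import finmap zify.
From mathcomp Require Import all_classical topology cantor.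

Set Implicit Arguments.
Unset Strict Implicit.
Unset Printing Implicit Defensive.

Local Open Scope classical_set_scope.
Local Open Scope nat_scope.
Implicit Types (u v a b c d e x y z : word) (p q w : cantor_space).
Implicit Types (f g h : homeo cantor_space) (A C D E : {fset word}).

(** * Continuity of maps whose coordinates each read finitely many bits *)

Lemma near_agree p n :
  \forall q \near p, forall j, j < n -> q j = p j.
Proof.
elim: n => [|n IH]; first exact: filterE.
have Hn : \forall q \near p, q n = p n.
  have := @proj_continuous nat (fun=> bool) n p [set b | b = p n].
  apply; exact: discrete_set1.
near=> q.
move=> j; rewrite ltnS leq_eqVlt => /predU1P[->|].
  by near: q.
by move: j; near: q.
Unshelve. all: by end_near. Qed.

(** The product topology is generated by the coordinates, so one coordinate [i] can be treated at a
    time. Its value is constant on the neighbourhood supplied by [near_agree]. *)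
Lemma finitary_continuous (F : cantor_space -> cantor_space) :
  (forall i, exists n, forall p q, (forall j, j < n -> q j = p j) -> F q i = F p i) ->
  continuous F.
Proof.
move=> FN p; apply/cvg_sup => i; move: p.
apply/(@continuousP _ (initial_topology (@^~ i))) => S [T oT <-].
rewrite openE => p /= Tp; have [n Fn] := FN i.
apply: filterS (near_agree p n) => q qp.
by rewrite /= /proj (Fn p q qp).
Qed.

(** * Prefixes, cones and disjointness of cones *)

Lemma prepend_cat u v w : prepend (u ++ v) w = prepend u (prepend v w).
Proof.
apply: funext => i; rewrite /prepend size_cat nth_cat subnDA.
case: (ltnP i (size u)) => iu; first by rewrite (leq_trans iu (leq_addr _ _)).
by rewrite -ltn_subLR.
Qed.

Lemma prepend_rcons u s w :
  prepend (rcons u s) w = prepend u (prepend [:: s] w).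
Proof. by rewrite -cats1 prepend_cat. Qed.

Lemma prepend_head w : w = prepend [:: w 0] (fun i => w i.+1).
Proof. by apply: funext => -[|i] //; rewrite /prepend /= subn1. Qed.

Lemma prepend_addn u w i : prepend u w (i + size u) = w i.
Proof. by rewrite /prepend ltnNge leq_addl addnK. Qed.

Lemma prepend_inj u : injective (prepend u).
Proof.
by move=> p q pq; apply: funext => i; rewrite -(prepend_addn u) pq prepend_addn.
Qed.

Lemma prepend_prefix u v p q :
  size u <= size v -> prepend u p = prepend v q -> prefix u v.
Proof.
move=> uv e; rewrite prefixE; apply/eqP.
apply: (@eq_from_nth _ false) => [|i]; rewrite size_take_min (minn_idPl uv) // => iu.
rewrite nth_take //; have := congr1 (@^~ i) e.
by rewrite /prepend iu (leq_trans iu uv).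
Qed.

Lemma prepend_word_inj u v : prepend u = prepend v -> u = v.
Proof.
wlog uv : u v / size u <= size v => [W e|e].
  by case: (leqP (size u) (size v)) => [/W|/ltnW/W ->//]; apply.
have /prefixP[[|s t] vE] := prepend_prefix uv (congr1 (@^~ (fun=> false)) e).
  by rewrite vE cats0.
(* If [v] continued [u] with a letter [s], the constant sequence [~~ s] would separate the two maps
   just after [u]. *)
have := congr1 (@^~ (fun=> ~~ s)) e.
rewrite vE prepend_cat => /prepend_inj/(congr1 (@^~ 0)).
by rewrite /prepend /=; case: s {vE}.
Qed.

Definition shift n p : cantor_space := fun i => p (i + n).

Lemma shift_prepend u w : shift (size u) (prepend u w) = w.
Proof. by apply: funext => i; apply: prepend_addn. Qed.

Lemma cone_prepend u w : cone u (prepend u w).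
Proof. by exists w. Qed.

Lemma cone_shift u p : cone u p -> p = prepend u (shift (size u) p).
Proof. by case=> w _ <-; rewrite shift_prepend. Qed.

Lemma cone_agree u p q :
  (forall j, j < size u -> q j = p j) -> cone u p -> cone u q.
Proof.
move=> qp /cone_shift up; exists (shift (size u) q) => //.
apply: funext => i; rewrite /prepend; case: ifPn => iu.
  by rewrite qp // up /prepend iu.
by rewrite /shift subnK // leqNgt.
Qed.

(** Disjointness of the two cones; equivalently, neither word is a prefix of the other. *)
Definition apart u v := forall p q, prepend u p <> prepend v q.

Lemma apartC u v : apart u v -> apart v u.
Proof. by move=> uv p q /esym; apply: uv. Qed.

Lemma apart_cone u v p : apart u v -> cone u p -> ~ cone v p.
Proof. by move=> uv [q _ <-] [r _ /esym]; apply: uv. Qed.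

Lemma apart_rcons u v s : apart u v -> apart (rcons u s) v.
Proof. by move=> uv p q; rewrite prepend_rcons; apply: uv. Qed.

Lemma apart_sibling u s t : s != t -> apart (rcons u s) (rcons u t).
Proof.
move=> st p q; rewrite !prepend_rcons => /prepend_inj/(congr1 (@^~ 0)).
by rewrite /prepend /= => e; rewrite e eqxx in st.
Qed.

Lemma apart_cat u v : ~ apart u (u ++ v).
Proof. by move=> /(_ (prepend v (fun=> false)) (fun=> false)); rewrite prepend_cat. Qed.

(** * Prefix replacement and supports of homeomorphisms *)

Definition sends h u v := forall w, h (prepend u w) = prepend v w.

Lemma sends_fun h u v v' : sends h u v -> sends h u v' -> v = v'.
Proof.
by move=> uv uv'; apply: prepend_word_inj; apply: funext => w; rewrite -uv.
Qed.

Lemma sendsM g h u v t : sends g u v -> sends h v t -> sends (g * h)%g u t.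
Proof. by move=> uv vt w; rewrite -vt -uv. Qed.

Lemma sendsV h u v : sends h u v -> sends h^-1%g v u.
Proof. by move=> uv w; rewrite -uv; apply: homeo_funK. Qed.

Lemma sends_inj h u u' v : sends h u v -> sends h u' v -> u = u'.
Proof. by move=> /sendsV uv /sendsV; apply: sends_fun. Qed.

Lemma sends_cat h u v t : sends h u v -> sends h (u ++ t) (v ++ t).
Proof. by move=> uv w; rewrite !prepend_cat uv. Qed.

Lemma sends_rcons h u v s : sends h u v -> sends h (rcons u s) (rcons v s).
Proof. by rewrite -!cats1; apply: sends_cat. Qed.

Lemma sends_halves h u v :
  sends h (rcons u false) (rcons v false) ->
  sends h (rcons u true) (rcons v true) -> sends h u v.
Proof.
move=> h0 h1 w; rewrite (prepend_head w).
by case: (w 0); rewrite -!prepend_rcons.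
Qed.

(** A bound on the support: [h] moves only points in the cones of the words in [S]. *)
Definition fixes_off (S : seq word) h :=
  forall p, (forall u, u \in S -> ~ cone u p) -> h p = p.

Lemma fixes_off_sends S h u :
  fixes_off S h -> (forall v, v \in S -> apart v u) -> sends h u u.
Proof.
move=> hS uS w; apply: hS => v vS; apply: apart_cone (cone_prepend u w).
exact/apartC/uS.
Qed.

Lemma fixes_offM S g h : fixes_off S g -> fixes_off S h -> fixes_off S (g * h)%g.
Proof. by move=> gS hS p pS; rewrite /= [RHS](_ : _ = h (g p)) // gS // hS. Qed.

Lemma fixes_offV S h : fixes_off S h -> fixes_off S h^-1%g.
Proof. by move=> hS p /hS hp; rewrite -[in LHS]hp; apply: homeo_funK. Qed.

Lemma fixes_offW (S T : seq word) h :
  {subset S <= T} -> fixes_off S h -> fixes_off T h.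
Proof. by move=> ST hS p pT; apply: hS => u /ST; apply: pT. Qed.

(** * Transpositions and 3-cycles of words *)

(** No basis is mentioned, so the same homeomorphism serves as a transposition in every basis
    containing both words. The same holds for [cyc3]. *)
Definition transp a b h :=
  [/\ sends h a b, sends h b a & fixes_off [:: a; b] h].

Definition cyc3 a b c h :=
  [/\ sends h a b, sends h b c, sends h c a & fixes_off [:: a; b; c] h].

Lemma transp_exists a b : apart a b -> exists h, transp a b h.
Proof.
move=> ab.
pose F p : cantor_space :=
  if pselect (cone a p) then prepend b (shift (size a) p)
  else if pselect (cone b p) then prepend a (shift (size b) p) else p.
have Fa w : F (prepend a w) = prepend b w.
  by rewrite /F; case: pselect => [?|nc]; [rewrite shift_prepend|case: nc; apply: cone_prepend].
have Fb w : F (prepend b w) = prepend a w.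
  rewrite /F; case: pselect => [aw|?]; first by case: (apart_cone ab aw); apply: cone_prepend.
  by case: pselect => [?|nc]; [rewrite shift_prepend|case: nc; apply: cone_prepend].
have F0 p : ~ cone a p -> ~ cone b p -> F p = p.
  by rewrite /F; case: pselect => // ? _; case: pselect.
have FK : cancel F F.
  move=> p; case: (pselect (cone a p)) => [[w _ <-]|ap]; first by rewrite Fa Fb.
  by case: (pselect (cone b p)) => [[w _ <-]|bp]; rewrite ?Fa ?Fb // !F0.
have Fc : continuous F.
  (* This many coordinates decide membership in both cones and include the one that [F] copies to
     position [i]. *)
  apply: finitary_continuous => i; exists (i + size a + size b).+1 => p q qp.
  have pq j : j < (i + size a + size b).+1 -> p j = q j by move=> /qp.
  have ca : cone a p <-> cone a q.
    by split; apply: cone_agree => j ja; [rewrite qp//|rewrite pq//]; lia.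
  have cb : cone b p <-> cone b q.
    by split; apply: cone_agree => j ja; [rewrite qp//|rewrite pq//]; lia.
  case: (pselect (cone a p)) => ap.
    rewrite (cone_shift ap) (cone_shift (proj1 ca ap)) !Fa /prepend /shift.
    by case: ifP => // _; apply: qp; lia.
  case: (pselect (cone b p)) => bp.
    rewrite (cone_shift bp) (cone_shift (proj1 cb bp)) !Fb /prepend /shift.
    by case: ifP => // _; apply: qp; lia.
  rewrite !F0 //; first by apply: qp; lia.
    by move/ca.
  by move/cb.
exists (Homeo FK FK Fc Fc); split=> // p pS.
by apply: F0; apply: pS; rewrite !inE eqxx ?orbT.
Qed.

Lemma cyc3_rot a b c h : cyc3 a b c h -> cyc3 b c a h.
Proof.
case=> ab bc ca off; split=> //; apply: fixes_offW off => u.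
by rewrite !inE => /or3P[] ->; rewrite ?orbT.
Qed.

Lemma cyc3V a b c h : cyc3 a b c h -> cyc3 c b a h^-1%g.
Proof.
case=> ab bc ca off; split; try exact: sendsV.
apply: fixes_offV; apply: fixes_offW off => u.
by rewrite !inE => /or3P[] ->; rewrite ?orbT.
Qed.

Lemma cyc3J a b c a' b' c' g h : cyc3 a b c g ->
  sends h a a' -> sends h b b' -> sends h c c' ->
  cyc3 a' b' c' (h^-1 * g * h)%g.
Proof.
case=> ab bc ca off ha hb hc.
split; try by apply: sendsM; [apply: sendsM; [apply: sendsV|]|]; eassumption.
move=> p pS; rewrite [LHS](_ : _ = h (g (homeo_inv h p))) // off ?homeo_invK // => u.
(* A point outside the three image cones pulls back under [h] to a point outside the original ones,
   which [g] fixes. *)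
have hd d d' : d' \in [:: a'; b'; c'] -> sends h d d' -> ~ cone d (homeo_inv h p).
  move=> dS dd' [w _ e]; apply: (pS d' dS); exists w => //.
  by rewrite -dd' e homeo_invK.
by rewrite !inE => /or3P[] /eqP ->; [apply: hd ha|apply: hd hb|apply: hd hc];
   rewrite !inE eqxx ?orbT.
Qed.

(** * Bases of Cantor space *)

Lemma basis_cover A p : is_basis A -> exists2 u, u \in A & cone u p.
Proof.
move=> [cA _ _]; have : [set: cantor_space] p by [].
by rewrite -cA => -[u]; exists u.
Qed.

Lemma basis_apart A u v :
  is_basis A -> u \in A -> v \in A -> u != v -> apart u v.
Proof.
move=> [_ /trivIsetP tA _] uA vA uv p q e.
have := tA u v uA vA uv; rewrite -subset0 => /(_ (prepend u p)); apply.
by split; [exact: cone_prepend|rewrite e; exact: cone_prepend].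
Qed.

Lemma is_basisI A :
  (forall p, exists2 u, u \in A & cone u p) ->
  (forall u v, u \in A -> v \in A -> u != v -> apart u v) -> is_basis A.
Proof.
move=> cA aA; split.
- by rewrite -subTset => p _; have [u uA up] := cA p; exists u.
- apply/trivIsetP => u v uA vA uv; rewrite -subset0 => p [up vp].
  exact: (apart_cone (aA u v uA vA uv) up vp).
- by move=> u _; exists (prepend u (fun=> false)); apply: cone_prepend.
Qed.

Lemma basis_prefix A u v :
  is_basis A -> u \in A -> v \in A -> prefix u v -> u = v.
Proof.
move=> bA uA vA /prefixP[t vE]; apply/eqP; apply: contraPT isT => uv _.
by apply: (@apart_cat u t); rewrite -vE; apply: basis_apart bA _ _ uv.
Qed.

(** The point [u] followed by zeros lies in the cone of some basis word, and two prefixes of one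
    point are comparable. *)
Lemma basis_refined A u : is_basis A ->
  exists2 a, a \in A & prefix a u || prefix u a.
Proof.
move=> bA; have [a aA [w _ e]] := basis_cover (prepend u (fun=> false)) bA.
exists a => //; case: (leqP (size a) (size u)) => [|/ltnW] s.
  by rewrite (prepend_prefix s e).
by rewrite (prepend_prefix s (esym e)) orbT.
Qed.

Lemma basis_long A : is_basis A ->
  exists n, forall u, n <= size u -> exists2 a, a \in A & prefix a u /\ size a <= n.
Proof.
move=> bA; pose n := (\max_(a <- A) size a).
have An a : a \in A -> size a <= n by move=> aA; apply: (leq_bigmax_seq _ aA).
clearbody n.
exists n => u nu; have [a aA] := basis_refined u bA.
case/orP => [au|/prefixP[t aE]]; exists a => //; split=> //; try exact: An.
(* Here [u] is a prefix of [a], and [a] has length at most [n], hence at most that of [u]. *)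
suff -> : a = u by apply: prefix_refl.
have := An a aA; rewrite aE size_cat => /leq_trans/(_ nu).
by rewrite -{2}[size u]addn0 leq_add2l leqn0 size_eq0 => /eqP->; rewrite cats0.
Qed.

(** * Iterated expansions and refinements *)

Definition expand C x : {fset word} :=
  (C `\ x `|` [fset rcons x false; rcons x true])%fset.

Lemma in_expand C x u :
  (u \in expand C x) =
  [|| (u != x) && (u \in C), u == rcons x false | u == rcons x true].
Proof. by rewrite !inE. Qed.

Lemma expand_old C x u : u \in C -> u != x -> u \in expand C x.
Proof. by move=> uC ux; rewrite in_expand uC ux. Qed.

Lemma expand_new C x s : rcons x s \in expand C x.
Proof. by rewrite in_expand; case: s; rewrite eqxx ?orbT. Qed.

Lemma in_expandP C x u : u \in expand C x ->
  (u \in C /\ u != x) \/ (exists s, u = rcons x s).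
Proof.
rewrite in_expand => /or3P[/andP[]|/eqP->|/eqP->]; [by left|right..].
  by exists false.
by exists true.
Qed.

Lemma expand_basis C x : is_basis C -> x \in C -> is_basis (expand C x).
Proof.
move=> bC xC; apply: is_basisI => [p|u v].
  have [u uC [w _ <-]] := basis_cover p bC.
  case: (eqVneq u x) => [->|ux].
    exists (rcons x (w 0)); first exact: expand_new.
    by rewrite (prepend_head w) -prepend_rcons; apply: cone_prepend.
  by exists u; [apply: expand_old|apply: cone_prepend].
move=> /in_expandP[[uC ux]|[s ->]] /in_expandP[[vC vx]|[t ->]] uv.
- exact: basis_apart bC _ _ uv.
- by apply/apartC/apart_rcons; apply: (basis_apart bC) => //; rewrite eq_sym.
- by apply/apart_rcons; apply: (basis_apart bC) => //; rewrite eq_sym.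
- by apply: apart_sibling; apply: contra_neq uv => ->.
Qed.

Lemma basis_rcons C x s : is_basis C -> x \in C -> rcons x s \notin C.
Proof.
move=> bC xC; apply/negP => xsC.
have /(congr1 size) := basis_prefix bC xC xsC (prefix_rcons _ _).
by rewrite size_rcons; lia.
Qed.

Lemma expand_card C x : is_basis C -> x \in C -> #|` expand C x| = #|` C|.+1.
Proof.
move=> bC xC; rewrite cardfsU cardfs2.
have -> : (rcons x false != rcons x true) = true.
  by apply/eqP => /rcons_inj[].
have -> : ((C `\ x) `&` [fset rcons x false; rcons x true])%fset = fset0.
  apply/fsetP => u; rewrite !inE; apply/negP => /andP[/andP[_ uC]].
  by case/orP => /eqP uE; move: uC; rewrite uE; apply/negP; apply: basis_rcons.
by have := cardfsD1 x C; rewrite xC cardfs0; lia.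
Qed.

(** The index counts the carets added. Over a basis it is determined by the size of the result,
    which later lets two expansions of equal size be compared. *)
Inductive expands A : nat -> {fset word} -> Prop :=
| expands0 : expands A 0 A
| expandsS n C x : expands A n C -> x \in C -> expands A n.+1 (expand C x).

Lemma expands0_inv A E : expands A 0 E -> E = A.
Proof. by move=> AE; inversion AE. Qed.

Lemma expandsS_inv A n E : expands A n.+1 E ->
  exists C x, [/\ expands A n C, x \in C & E = expand C x].
Proof. by move=> AE; inversion AE; exists C, x. Qed.

Lemma expands_basis A n C : is_basis A -> expands A n C -> is_basis C.
Proof. by move=> bA; elim=> // {}n {}C x _ bC; apply: expand_basis. Qed.

Lemma expands_card A n C :
  is_basis A -> expands A n C -> #|` C| = #|` A| + n.
Proof.
move=> bA; elim=> [|{}n {}C x AC IH xC]; first by rewrite addn0.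
by rewrite expand_card ?IH ?addnS //; apply: expands_basis bA AC.
Qed.

Lemma expands_expand A x n C :
  x \in A -> expands (expand A x) n C -> expands A n.+1 C.
Proof.
move=> xA; elim=> [|{}n {}C y _ IH yC]; last exact: expandsS.
exact: expandsS (expands0 A) xA.
Qed.

Definition refines D C := forall d, d \in D -> exists2 c, c \in C & prefix c d.

(** Each [c] in [C] is a prefix of some word of [D], and this choice is injective because distinct
    words of [C] have disjoint cones. *)
Lemma refines_card C D :
  is_basis C -> is_basis D -> refines D C -> #|` C| <= #|` D|.
Proof.
move=> bC bD DC.
have /choice[F FP] : forall c, exists d, c \in C -> d \in D /\ prefix c d.
  move=> c; case: (boolP (c \in C)) => cC; last by exists c.
  have [d dD /orP[dc|cd]] := basis_refined c bD; last by exists d.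
  (* If [d] is a prefix of [c], the word of [C] that is a prefix of [d] must be [c] itself, so [c]
     is a prefix of [d] after all. *)
  have [c' c'C c'd] := DC d dD.
  have e := basis_prefix bC c'C cC (prefix_trans c'd dc).
  by exists d => _; split=> //; rewrite -e.
have Finj : {in C &, injective F}.
  move=> c c' cC c'C e; apply: contraTeq isT => cc'.
  have [_ /prefixP[t Ft]] := FP c cC; have [_ /prefixP[t' Ft']] := FP c' c'C.
  have /(_ (prepend t (fun=> false)) (prepend t' (fun=> false)))[] := basis_apart bC cC c'C cc'.
  by rewrite -!prepend_cat -Ft -Ft' e.
move/card_in_imfsetP: Finj => /eqP <-; apply/fsubset_leq_card/fsubsetP => d.
by case/imfsetP => c /= cC ->; have [] := FP c cC.
Qed.

(** A word of [D] extending [c] does so properly, hence passes through one of the two halves of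
    [c]. *)
Lemma refines_expand C D c :
  refines D C -> c \notin D -> refines D (expand C c).
Proof.
move=> DC cD d dD; have [c' c'C c'd] := DC d dD.
case: (eqVneq c' c) => [c'E|c'c]; last by exists c' => //; apply: expand_old.
have /prefixP[[|s t] dE] := c'd; first by rewrite -c'E -(cats0 c') -dE dD in cD.
exists (rcons c s); first exact: expand_new.
by rewrite dE c'E -cat_rcons prefix_prefix.
Qed.

(** As long as some word of [C] is missing from [D], expand [C] there. By [refines_card] the size
    never exceeds that of [D], so this stops, and a basis contained in a basis refining it equals
    it. *)
Lemma refines_expands C D :
  is_basis C -> is_basis D -> refines D C -> exists n, expands C n D.
Proof.
move=> bC bD; have [k] := ubnP (#|` D| - #|` C|).
elim: k C bC => [//|k IH] C bC kCD DC.
have [CD|/fsubsetPn[c cC cD]] := boolP (C `<=` D)%fset.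
  exists 0; suff -> : D = C by apply: expands0.
  apply/esym/eqP; rewrite eqEfsubset CD; apply/fsubsetP => d dD.
  by have [c cC cd] := DC d dD; rewrite -(basis_prefix bD (fsubsetP CD c cC) dD cd).
have DCc := refines_expand DC cD; have bCc := expand_basis bC cC.
have leC := refines_card bCc bD DCc.
have [|n Cn] := IH (expand C c) bCc _ DCc; first by rewrite expand_card // in leC *; lia.
by exists n.+1; apply: expands_expand Cn.
Qed.

(** * Homeomorphisms carrying one basis to another *)

(** Between bases such an [h] induces a bijection of words, since the images of the cones already
    cover the space. *)
Definition carries h E E' := forall a, a \in E -> exists2 a', a' \in E' & sends h a a'.

Lemma carriesM g h C D E :
  carries g C D -> carries h D E -> carries (g * h)%g C E.
Proof.
move=> gCD hDE a /gCD[b /hDE[c cE bc] ab].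
by exists c => //; apply: sendsM ab bc.
Qed.

Lemma carries_expand h C C' x y :
  carries h C C' -> sends h x y -> carries h (expand C x) (expand C' y).
Proof.
move=> hC xy a /in_expandP[[aC ax]|[s ->]]; last first.
  by exists (rcons y s); [apply: expand_new|apply: sends_rcons].
have [a' a'C aa'] := hC a aC; exists a' => //; apply: expand_old => //.
by apply: contra_neq ax => e; rewrite e in aa'; apply: sends_inj aa' xy.
Qed.

Lemma basis_homeo_eq E g h : is_basis E ->
  (forall u, u \in E -> exists2 v, sends g u v & sends h u v) -> g = h.
Proof.
move=> bE gh; apply: homeo_eqP => p; have [u uE [w _ <-]] := basis_cover p bE.
by have [v gv hv] := gh u uE; rewrite gv hv.
Qed.

Lemma exists_third C x y : 3 <= #|` C| -> exists z, [/\ z \in C, z != x & z != y].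
Proof.
move=> C3; have /fsubsetPn[z zC] : ~~ (C `<=` [fset x; y])%fset.
  apply/negP => /fsubset_leq_card; rewrite cardfs2.
  by move=> /(leq_trans C3); case: (x != y).
by rewrite !inE negb_or => /andP[zx zy]; exists z.
Qed.

Lemma transp_tperm E (a b u : E) h : is_basis E ->
  transp (val a) (val b) h -> sends h (val u) (val (tperm a b u)).
Proof.
move=> bE [ab ba off]; case: tpermP => [->//|->//|ua ub].
apply: (fixes_off_sends off) => v.
rewrite !inE => /orP[] /eqP ->; apply: (basis_apart bE); rewrite ?fsvalP //.
  by apply/eqP => /val_inj/esym.
by apply/eqP => /val_inj/esym.
Qed.

(** * Subgroups containing the 3-cycles of a basis *)

Section Subgroup.
Variable H : set (homeo cantor_space).
Hypothesis Hgroup : group_closed [in H].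

Let H1 : H 1%g. Proof. by have [/set_mem] := Hgroup. Qed.
Let HV h : H h -> H h^-1%g.
Proof. by move=> /mem_set Hh; apply/set_mem/(group_closedV Hgroup). Qed.
Let HM g h : H g -> H h -> H (g * h)%g.
Proof. by move=> /mem_set Hg /mem_set Hh; apply/set_mem/(group_closedM Hgroup). Qed.

Definition has_cyc3 a b c := exists2 g, H g & cyc3 a b c g.

Lemma has_cyc3_rot a b c : has_cyc3 a b c -> has_cyc3 b c a.
Proof. by case=> g Hg /cyc3_rot; exists g. Qed.

Lemma has_cyc3V a b c : has_cyc3 a b c -> has_cyc3 c b a.
Proof. by case=> g Hg /cyc3V; exists g^-1%g => //; apply: HV. Qed.

Lemma has_cyc3J a b c a' b' c' h : H h -> has_cyc3 a b c ->
  sends h a a' -> sends h b b' -> sends h c c' -> has_cyc3 a' b' c'.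
Proof.
move=> Hh [g Hg gabc] ha hb hc; exists (h^-1 * g * h)%g.
  by apply: HM => //; apply: HM => //; apply: HV.
exact: cyc3J gabc ha hb hc.
Qed.

(** For a basis [C] this expresses that [H] contains Alt(C), which is generated by its 3-cycles. *)
Definition alternating C := forall a b c, a \in C -> b \in C -> c \in C ->
  a != b -> b != c -> a != c -> has_cyc3 a b c.

Lemma alternating_carry h E E' :
  H h -> carries h E E' -> alternating E' -> alternating E.
Proof.
move=> Hh hE altE a b c /hE[a' a'E ha] /hE[b' b'E hb] /hE[c' c'E hc] ab bc ac.
apply: (has_cyc3J (HV Hh) (altE a' b' c' a'E b'E c'E _ _ _)); try exact: sendsV.
- by apply: contra_neq ab => e; rewrite e in ha; apply: sends_inj ha hb.
- by apply: contra_neq bc => e; rewrite e in hb; apply: sends_inj hb hc.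
- by apply: contra_neq ac => e; rewrite e in ha; apply: sends_inj ha hc.
Qed.

(** With a third word [z], the 3-cycle (x y z) permutes [C] and takes [x] to [y], hence the halves
    of [x] to those of [y]. *)
Lemma move_caret C x y : is_basis C -> 3 <= #|` C| -> alternating C ->
  x \in C -> y \in C -> exists2 h, H h & carries h (expand C x) (expand C y).
Proof.
move=> bC C3 altC xC yC; case: (eqVneq x y) => [<-|xy].
  by exists 1%g => // a aC; exists a.
have [z [zC zx zy]] := exists_third x y C3.
have [h Hh [hx hy hz off]] : has_cyc3 x y z by apply: altC => //; rewrite eq_sym.
exists h => //; apply: (carries_expand _ hx) => a aC.
case: (eqVneq a x) => [->|ax]; first by exists y.
case: (eqVneq a y) => [->|ay]; first by exists z.
case: (eqVneq a z) => [->|az]; first by exists x.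
exists a => //; apply: (fixes_off_sends off) => v.
by rewrite !inE => /or3P[] /eqP ->; apply: (basis_apart bC) => //; rewrite eq_sym.
Qed.

Lemma alternating_expand_move C x y : is_basis C -> 3 <= #|` C| -> alternating C ->
  x \in C -> y \in C -> alternating (expand C x) -> alternating (expand C y).
Proof.
move=> bC C3 altC xC yC; have [h Hh hyx] := move_caret bC C3 altC yC xC.
exact: alternating_carry Hh hyx.
Qed.

(** A triple that does not meet the halves of both [x] and [y] lies in one of the two single
    expansions. The mixed triples are obtained by conjugation, starting from a third word [z]. *)
Lemma alternating_expand2 C x y : is_basis C -> 3 <= #|` C| ->
  x \in C -> y \in C -> x != y ->
  alternating (expand C x) -> alternating (expand C y) ->
  alternating (expand (expand C x) y).
Proof.
move=> bC C3 xC yC xy altx alty.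
have bx := expand_basis bC xC; have by' := expand_basis bC yC.
have [z [zC zx zy]] := exists_third x y C3.
have in_x c : c \in C -> c != x -> c \in expand C x by apply: expand_old.
have in_y c : c \in C -> c != y -> c \in expand C y by apply: expand_old.
have neq_old c d s : c \in C -> d \in C -> c != rcons d s.
  by move=> cC dC; apply: contraTneq cC => ->; apply: basis_rcons.
have sib d s : rcons d s != rcons d (~~ s) :> word.
  by apply/eqP => /rcons_inj[]; case: s.
have apart_xy s t : apart (rcons x s) (rcons y t).
  by apply/apart_rcons/apartC/apart_rcons; apply: (basis_apart bC) => //; rewrite eq_sym.
have apart_x s c : c \in C -> c != x -> apart (rcons x s) c.
  by move=> cC cx; apply/apart_rcons; apply: (basis_apart bC) => //; rewrite eq_sym.
have apart_y s c : c \in C -> c != y -> apart (rcons y s) c.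
  by move=> cC cx; apply/apart_rcons; apply: (basis_apart bC) => //; rewrite eq_sym.
(* (x_s x_s' z) conjugated by (z y_t y_t') is (x_s x_s' y_t). *)
have xxy s t : has_cyc3 (rcons x s) (rcons x (~~ s)) (rcons y t).
  have xxz : has_cyc3 (rcons x s) (rcons x (~~ s)) z.
    by apply: altx; rewrite ?expand_new ?in_x ?sib // eq_sym neq_old.
  have [h Hh [hz h1 h2 off]] : has_cyc3 z (rcons y t) (rcons y (~~ t)).
    by apply: alty; rewrite ?expand_new ?in_y ?sib ?neq_old.
  apply: (has_cyc3J Hh xxz _ _ hz); apply: (fixes_off_sends off) => v;
    by rewrite !inE => /or3P[] /eqP ->; (by apply/apartC/apart_x) || by apply/apartC/apart_xy.
have yyx s t : has_cyc3 (rcons y t) (rcons y (~~ t)) (rcons x s).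
  have yyz : has_cyc3 (rcons y t) (rcons y (~~ t)) z.
    by apply: alty; rewrite ?expand_new ?in_y ?sib // eq_sym neq_old.
  have [h Hh [hz h1 h2 off]] : has_cyc3 z (rcons x s) (rcons x (~~ s)).
    by apply: altx; rewrite ?expand_new ?in_x ?sib ?neq_old.
  apply: (has_cyc3J Hh yyz _ _ hz); apply: (fixes_off_sends off) => v;
    by rewrite !inE => /or3P[] /eqP ->; (by apply/apartC/apart_y) || by apply/apart_xy.
(* (x_s x_s' y_t) conjugated by (x_s c x_s') is (c x_s y_t). *)
have cxy c s t : c \in C -> c != x -> c != y -> has_cyc3 c (rcons x s) (rcons y t).
  move=> cC cx cy.
  have [h Hh [h1 h2 h3 off]] : has_cyc3 (rcons x s) c (rcons x (~~ s)).
    by apply: altx; rewrite ?expand_new ?in_x ?sib ?neq_old // eq_sym neq_old.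
  apply: (has_cyc3J Hh (xxy s t) h1 h3); apply: (fixes_off_sends off) => v.
  by rewrite !inE => /or3P[] /eqP ->; (by apply/apartC/apart_y) || by apply/apart_xy.
have inE2 d : d \in expand (expand C x) y ->
    [\/ [/\ d \in C, d != x & d != y], exists s, d = rcons x s | exists t, d = rcons y t].
  move=> /in_expandP[[/in_expandP[[dC dx]|[s ->]] dy]|[t ->]];
    [by apply: Or31|by apply: Or32; exists s|by apply: Or33; exists t].
(* Distinct halves of one word are siblings, which brings triples with two such halves into the form
   of [xxy] or [yyx]. *)
have bneq (s t : bool) d : rcons d s != rcons d t :> word -> t = ~~ s.
  by case: s t => -[]; rewrite ?eqxx.
(* In each case split: an old word, a half of x, a half of y. *)
move=> a b c /inE2[[aC ax ay]|[s ->]|[s ->]] /inE2[[bC' bx' by'']|[t ->]|[t ->]]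
  /inE2[[cC cx cy]|[r ->]|[r ->]] ab bc ac.
- by apply: altx; rewrite ?expand_new ?in_x.
- by apply: altx; rewrite ?expand_new ?in_x.
- by apply: alty; rewrite ?expand_new ?in_y.
- by apply: altx; rewrite ?expand_new ?in_x.
- by apply: altx; rewrite ?expand_new ?in_x.
- exact: cxy.
- by apply: alty; rewrite ?expand_new ?in_y.
- exact/has_cyc3_rot/has_cyc3_rot/has_cyc3V/cxy.
- by apply: alty; rewrite ?expand_new ?in_y.
- by apply: altx; rewrite ?expand_new ?in_x.
- by apply: altx; rewrite ?expand_new ?in_x.
- exact/has_cyc3_rot/has_cyc3V/cxy.
- by apply: altx; rewrite ?expand_new ?in_x.
- by apply: altx; rewrite ?expand_new ?in_x.
- rewrite (bneq _ _ _ ab); exact: xxy.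
- exact/has_cyc3_rot/cxy.
- rewrite eq_sym in ac; rewrite (bneq _ _ _ ac); exact/has_cyc3_rot/xxy.
- rewrite (bneq _ _ _ bc); exact/has_cyc3_rot/has_cyc3_rot/yyx.
- by apply: alty; rewrite ?expand_new ?in_y.
- exact/has_cyc3_rot/has_cyc3_rot/cxy.
- by apply: alty; rewrite ?expand_new ?in_y.
- exact/has_cyc3V/cxy.
- rewrite (bneq _ _ _ bc); exact/has_cyc3_rot/has_cyc3_rot/xxy.
- rewrite eq_sym in ac; rewrite (bneq _ _ _ ac); exact/has_cyc3_rot/yyx.
- by apply: alty; rewrite ?expand_new ?in_y.
- rewrite (bneq _ _ _ ab); exact: yyx.
- by apply: alty; rewrite ?expand_new ?in_y.
Qed.

(** In the right action (a b)(a c) is the 3-cycle a, b, c; as a product of two transpositions it is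
    even. *)
Lemma Alt_of_alternating A :
  is_basis A -> Alt_of A `<=` H -> alternating A.
Proof.
move=> bA AH a b c aA bA' cA ab bc ac.
have [s ts] := transp_exists (basis_apart bA aA bA' ab).
have [t tt] := transp_exists (basis_apart bA aA cA ac).
pose a' : A := [` aA]%fset; pose b' : A := [` bA']%fset; pose c' : A := [` cA]%fset.
have ab' : a' != b' by apply: contra_neq ab => /(congr1 val).
have ac' : a' != c' by apply: contra_neq ac => /(congr1 val).
have bc' : b' != c' by apply: contra_neq bc => /(congr1 val).
have st (u : A) : sends (s * t)%g (val u) (val ((tperm a' b' * tperm a' c')%g u)).
  rewrite permM; apply: sendsM (_ : sends t _ _).
    exact: (transp_tperm (a := a') (b := b')).
  exact: (transp_tperm (a := a') (b := c')).
exists (s * t)%g.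
  apply: AH; exists (tperm a' b' * tperm a' c')%g; last exact: st.
  by rewrite Alt_even odd_mul_tperm odd_tperm ab' ac'.
split.
- by have := st a'; rewrite permM tpermL tpermD // eq_sym.
- by have := st b'; rewrite permM tpermR tpermL.
- by have := st c'; rewrite permM [tperm a' b' c']tpermD ?tpermR // eq_sym.
by apply: fixes_offM; [case: ts|case: tt] => _ _; apply: fixes_offW => u;
  rewrite !inE => /orP[] ->; rewrite ?orbT.
Qed.

(** The permutation that [h] induces on [E] is a product of transpositions. The corresponding
    product in [H] agrees with [h] on every cone of [E], so it equals [h]. *)
Lemma carries_self_in E h : is_basis E ->
  (forall a b, a \in E -> b \in E -> a != b -> exists2 g, H g & transp a b g) ->
  carries h E E -> H h.
Proof.
move=> bE HE hE.
have /choice[s sP] : forall u : E, exists v : E, sends h (val u) (val v).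
  by move=> u; have [v vE uv] := hE (val u) (fsvalP u); exists [` vE]%fset.
have s_inj : injective s.
  by move=> u v e; apply/val_inj/(sends_inj (sP u)); rewrite e.
have [ts sE dts] := prod_tpermP (perm s_inj).
suff [g Hg gP] : exists2 g, H g &
    forall u : E, sends g (val u) (val ((\prod_(t <- ts) tperm t.1 t.2)%g u)).
  suff -> : h = g by [].
  apply: (basis_homeo_eq bE) => u uE; exists (val (s [` uE]%fset)); first exact: (sP [` uE]%fset).
  by have := gP [` uE]%fset; rewrite -sE permE.
elim: ts dts {sE} => [_|[a b] ts IH /= /andP[ab /IH[g Hg gP]]].
  by exists 1%g => // u; rewrite big_nil perm1.
have [k Hk kab] : exists2 k, H k & transp (val a) (val b) k.
  by apply: HE; rewrite ?fsvalP //; apply: contra_neq ab => /val_inj.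
exists (k * g)%g => [|u]; first exact: HM.
rewrite big_cons permM; apply: sendsM (gP _).
exact: transp_tperm.
Qed.

(** * Iterated expansions of the given basis *)

Section Expansions.
Variables (A : {fset word}) (x0 : word).
Hypotheses (bA : is_basis A) (A3 : 3 <= #|` A|) (x0A : x0 \in A).
Hypotheses (altA : alternating A) (altA0 : alternating (expand A x0)).

Lemma expands_card3 n E : expands A n E -> 3 <= #|` E|.
Proof. by move=> AE; rewrite (expands_card bA AE) (leq_trans A3) ?leq_addr. Qed.

(** The second half strengthens the induction. For [E] equal to [C] expanded at [x], choose another
    [z] in [C]: [alternating_expand2] handles [E] expanded at [z], and the caret at [z] then moves
    to any [y] in [E]. *)
Lemma expands_alternating_expand n E : expands A n E ->
  alternating E /\ forall x, x \in E -> alternating (expand E x).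
Proof.
elim=> [|{}n C x AC [altC altCx] xC].
  by split=> // x xA; apply: alternating_expand_move bA A3 altA x0A xA altA0.
have bC := expands_basis bA AC; have C3 := expands_card3 AC.
have AE := expandsS AC xC; split=> [|y yE]; first exact: altCx.
have [z [zC zx _]] := exists_third x x C3.
apply: alternating_expand_move (expands_basis bA AE) (expands_card3 AE) (altCx x xC) _ yE _.
  exact: expand_old zC zx.
by apply: (alternating_expand2 bC C3 xC zC _ (altCx x xC) (altCx z zC)); rewrite eq_sym.
Qed.

Lemma expands_alternating n E : expands A n E -> alternating E.
Proof. by case/expands_alternating_expand. Qed.

(** Strip the last caret from both sides and carry the remaining bases by induction. The caret of
    [E] lands at some word [y], from which [move_caret] takes it to its place in [E']. *)
Lemma expands_carry n E E' : expands A n E -> expands A n E' ->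
  exists2 h, H h & carries h E E'.
Proof.
move=> AE; elim: AE E' => [|{}n C x AC IH xC] E'.
  by move=> /expands0_inv ->; exists 1%g => // a aA; exists a.
case/expandsS_inv=> C' [x' [AC' x'C' ->]].
have [h Hh hCC'] := IH C' AC'.
have [y yC' xy] := hCC' x xC.
have [k Hk kyx'] := move_caret (expands_basis bA AC') (expands_card3 AC')
  (expands_alternating AC') yC' x'C'.
exists (h * k)%g; first exact: HM.
by apply: carriesM kyx'; apply: carries_expand xy.
Qed.

(* (a b) = (a0 b0)(a1 b1) = (a0 b0 a1)(a0 b1 a1) *)
Lemma expands_transp n E a b : expands A n E -> a \in E -> b \in E -> a != b ->
  exists2 h, H h & transp a b h.
Proof.
move=> AE aE bE ab.
have ba : b != a by rewrite eq_sym.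
have altF := expands_alternating (expandsS (expandsS AE aE) (expand_old bE ba)).
have bF := expands_basis bA (expandsS (expandsS AE aE) (expand_old bE ba)).
set F := expand _ b in altF bF.
have abs s t : rcons a s != rcons b t.
  by apply/eqP => /rcons_inj[e _]; rewrite e eqxx in ab.
have sib d s : rcons d s != rcons d (~~ s) :> word.
  by apply/eqP => /rcons_inj[]; case: s.
have aF s : rcons a s \in F.
  apply: expand_old; first exact: expand_new.
  apply: contraTneq (bE) => <-; apply: basis_rcons => //; exact: expands_basis AE.
have bF' s : rcons b s \in F by apply: expand_new.
have aps s t : apart (rcons a s) (rcons b t) by apply: (basis_apart bF).
have apb s : apart (rcons b s) (rcons b (~~ s)) by apply: apart_sibling; case: s.
have [g Hg [g1 g2 g3 offg]] : has_cyc3 (rcons a false) (rcons b false) (rcons a true).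
  by apply: altF; rewrite ?abs // ?[rcons b _ == _]eq_sym ?abs //; apply: (sib a false).
have [h Hh [h1 h2 h3 offh]] : has_cyc3 (rcons a false) (rcons b true) (rcons a true).
  by apply: altF; rewrite ?abs // ?[rcons b _ == _]eq_sym ?abs //; apply: (sib a false).
have fg : sends g (rcons b true) (rcons b true).
  apply: (fixes_off_sends offg) => v; rewrite !inE => /or3P[] /eqP ->; try exact: aps.
  exact: (apb false).
have fh : sends h (rcons b false) (rcons b false).
  apply: (fixes_off_sends offh) => v; rewrite !inE => /or3P[] /eqP ->; try exact: aps.
  exact: (apb true).
exists (g * h)%g; first exact: HM.
split.
- by apply: sends_halves; [apply: sendsM g1 fh|apply: sendsM g3 h1].
- by apply: sends_halves; [apply: sendsM g2 h3|apply: sendsM fg h2].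
move=> p pab; rewrite [LHS](_ : _ = h (g p)) //.
have no d s : d \in [:: a; b] -> ~ cone (rcons d s) p.
  by move=> /pab nd [w _ e]; apply: nd; rewrite -e prepend_rcons; apply: cone_prepend.
rewrite offg ?offh // => v; rewrite !inE => /or3P[] /eqP ->; apply: no;
  by rewrite !inE eqxx ?orbT.
Qed.

End Expansions.
End Subgroup.

(** * Thompson's group V is closed under the group operations *)

Lemma image_basis D (F : word -> word) h : is_basis D ->
  (forall u, u \in D -> sends h u (F u)) -> is_basis [fset F u | u in D]%fset.
Proof.
move=> bD hF; apply: is_basisI => [p|_ _ /imfsetP[u /= uD ->] /imfsetP[v /= vD ->] uv].
  have [u uD [w _ e]] := basis_cover (homeo_inv h p) bD.
  exists (F u); first by apply/imfsetP; exists u.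
  by rewrite -(homeo_invK h p) -e hF //; apply: cone_prepend.
move=> p q; rewrite -!hF // => /(can_inj (homeo_funK h)).
by apply: (basis_apart bD uD vD); apply: contra_neq uv => ->.
Qed.

Lemma image_card D (F : word -> word) h :
  (forall u, u \in D -> sends h u (F u)) -> #|` [fset F u | u in D]%fset| = #|` D|.
Proof.
move=> hF; apply/eqP/card_in_imfsetP => u v uD vD e.
by apply: sends_inj (hF u uD) _; rewrite e; apply: hF.
Qed.

Lemma sends_choice D h : (forall u, u \in D -> exists v, sends h u v) ->
  exists F : word -> word, forall u, u \in D -> sends h u (F u).
Proof.
move=> hD; have /choice[F hF] : forall u, exists v, u \in D -> sends h u v.
  by move=> u; have [/hD[v uv]|uD] := boolP (u \in D); [exists v|exists u].
by exists F.
Qed.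

(** A criterion with one basis only: the image words form the second basis, and equal cardinality
    makes the induced injection bijective. *)
Lemma thompson_VI D h : is_basis D ->
  (forall u, u \in D -> exists v, sends h u v) -> thompson_V h.
Proof.
move=> bD /sends_choice[F hF]; exists D, [fset F u | u in D]%fset.
split=> //; first exact: image_basis hF.
have FE (u : D) : F (val u) \in [fset F u | u in D]%fset.
  by apply/imfsetP; exists (val u) => //; apply: fsvalP.
exists (fun u : D => [` FE u]%fset); split=> [|u w /=]; last exact: hF (fsvalP u) w.
apply: inj_card_bij => [u v /(congr1 val)/= e|].
  have := hF _ (fsvalP v); rewrite -e => vu; exact/val_inj/(sends_inj (hF _ (fsvalP u)) vu).
by rewrite -!cardfE (image_card hF).
Qed.

(** A long word extends a word of the source basis, and replacing that prefix loses at most [n]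
    letters. The length bound keeps images of long words long. *)
Lemma thompson_V_sends h : thompson_V h -> exists n, forall u, n <= size u ->
  exists2 v, sends h u v & size u <= size v + n.
Proof.
move=> [D [E [bD _ [g [_ gh]]]]]; have [n Dn] := basis_long bD.
exists n => u nu; have [d dD [/prefixP[t ->] dn]] := Dn u nu.
exists (val (g [` dD]%fset) ++ t); first exact: sends_cat (gh [` dD]%fset).
by rewrite !size_cat addnAC leq_add2r (leq_trans dn) ?leq_addl.
Qed.

Definition words n : {fset word} := [fset tval t | t in {: n.-tuple bool}]%fset.

Lemma in_words n u : (u \in words n) = (size u == n).
Proof.
apply/imfsetP/idP => [[t _ ->]|/eqP un]; first by rewrite size_tuple.
by exists (tcast un (in_tuple u)) => //; rewrite val_tcast.
Qed.

Lemma words_basis n : is_basis (words n).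
Proof.
apply: is_basisI => [p|u v].
  exists (mkseq p n); first by rewrite in_words size_mkseq.
  exists (shift n p) => //; apply: funext => i; rewrite /prepend size_mkseq.
  by case: ltnP => ni; [rewrite nth_mkseq|rewrite /shift subnK].
rewrite !in_words => /eqP un /eqP vn uv p q e.
have /prefixP[t vE] : prefix u v by apply: prepend_prefix e; rewrite un vn.
move: uv; rewrite vE; have := congr1 size vE.
rewrite size_cat un vn -{1}[n]addn0 => /addnI/esym/size0nil ->.
by rewrite cats0 eqxx.
Qed.

Lemma thompson_VM g h : thompson_V g -> thompson_V h -> thompson_V (g * h)%g.
Proof.
move=> /thompson_V_sends[m gm] /thompson_V_sends[n hn].
(* Applying [g] costs at most [m] letters, so [n] remain, enough for [h]. *)
apply: (thompson_VI (words_basis (m + n))) => u; rewrite in_words => /eqP us.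
have [|v uv sv] := gm u; first by rewrite us leq_addr.
have [|t vt _] := hn v; first by rewrite us addnC leq_add2r in sv.
by exists t; apply: sendsM uv vt.
Qed.

Lemma thompson_VV h : thompson_V h -> thompson_V h^-1%g.
Proof.
move=> [D [E [bD bE [g [[g' gK g'K] gh]]]]]; exists E, D; split=> //.
exists g'; split=> [|u]; first by exists g.
by apply: sendsV; rewrite -{2}(g'K u); apply: gh.
Qed.

Lemma thompson_V_group : group_closed [in thompson_V].
Proof.
split=> [|g h /set_mem gV /set_mem hV]; apply/mem_set.
  by apply: (thompson_VI (words_basis 0)) => u _; exists u.
exact: thompson_VM gV (thompson_VV hV).
Qed.

Lemma Alt_of_sub_thompson_V A : is_basis A -> Alt_of A `<=` thompson_V.
Proof.
move=> bA h [g _ gh]; exists A, A; split=> //; exists g; split=> //.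
exact/injF_bij/perm_inj.
Qed.

(** * Generation of V *)

Lemma thompson_V_in_subgroup (H : set (homeo cantor_space)) A x :
  group_closed [in H] -> is_basis A -> 3 <= #|` A| -> x \in A ->
  Alt_of A `<=` H -> Alt_of (expand A x) `<=` H -> thompson_V `<=` H.
Proof.
move=> gH bA A3 xA AH BH h hV.
have altA := Alt_of_alternating bA AH.
have altB := Alt_of_alternating (expand_basis bA xA) BH.
have [n hn] := thompson_V_sends hV; have [k Ak] := basis_long bA.
(* On words of length [n + k], [h] replaces prefixes and leaves at least [k] letters, so both [D]
   and its image refine [A]. *)
pose D := words (n + k); have bD : is_basis D := words_basis _.
have Dsize u : u \in D -> size u = n + k by rewrite in_words => /eqP.
have [F hF] : exists F : word -> word, forall u, u \in D -> sends h u (F u).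
  apply: sends_choice => u /Dsize us; have [|v] := hn u; last by exists v.
  by rewrite us leq_addr.
have Fsize u : u \in D -> k <= size (F u).
  move=> uD; have us := Dsize u uD; have [|v uv] := hn u; first by rewrite us leq_addr.
  by rewrite (sends_fun (hF u uD) uv) us addnC leq_add2r.
pose E := [fset F u | u in D]%fset; have bE : is_basis E := image_basis bD hF.
have [i AD] : exists i, expands A i D.
  apply: refines_expands => // u /Dsize us.
  by have [|a aA []] := Ak u; [rewrite us leq_addl|exists a].
have [j AE] : exists j, expands A j E.
  apply: refines_expands => // _ /imfsetP[u /= uD ->].
  by have [a aA []] := Ak (F u) (Fsize u uD); exists a.
(* [D] and its image have equal size, so they arise from [A] by equally many expansions. *)
have ij : j = i.
  apply: (@addnI #|` A|); rewrite -(expands_card bA AD) -(expands_card bA AE).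
  exact: image_card hF.
rewrite ij in AE; have [g Hg gED] := expands_carry gH bA A3 xA altA altB AE AD.
(* As [g] carries the image [E] back to [D], the product [h * g] permutes the words of [D]. *)
suff /mem_set Hhg : H (h * g)%g.
  have := group_closedM gH Hhg (group_closedV gH (mem_set Hg)).
  by rewrite mulgK => /set_mem.
apply: (carries_self_in gH bD) => [a b|].
  exact (@expands_transp H gH A x bA A3 xA altA altB i D a b AD).
apply: (carriesM (D := E)) gED => u uD; exists (F u); last exact: hF.
by apply/imfsetP; exists u.
Qed.

(* The word un is the last element u_n in the enumeration of A. *)
Theorem theorem2p9 (A : {fset word}) (un : word) :
  is_basis A -> (3 <= #|` A|)%N -> un \in A ->
  let B := (A `\ un `|` [fset rcons un false; rcons un true])%fset in
  thompson_V = generated_subgroup (Alt_of A `|` Alt_of B).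
Proof.
(* [B] is [expand A un] by definition. *)
move=> bA A3 unA B; have bB : is_basis B := expand_basis bA unA.
apply/seteqP; split=> [h hV H [gH]|].
  rewrite subUset => -[AH BH].
  exact: (thompson_V_in_subgroup gH bA A3 unA AH BH).
apply: smallest_sub; first exact: thompson_V_group.
by rewrite subUset; split; apply: Alt_of_sub_thompson_V.
Qed.
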